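(* Suppose $(G,\|\cdot\|)$ is a finitely generated group equipped with a norm, $H$ is an expanding group endomorphism of $G$ with $H(G)$ of finite index in $G$, and $V$ is a good complete digit set with respect to $H$. Let $\Lambda$ be a finite set. If $x\in\Lambda^G$ is $(V,H)$-automatic, then $\mathsf{Rate}(x)=0$.
   Context: A norm on $G$ is a map $\|\cdot\|:G\to[0,\infty)$ with $\|g\|=0$ iff $g=e$, $\|g\|=\|g^{-1}\|$, and $\|gg'\|\le\|g\|+\|g'\|$ for all $g,g'\in G$. An endomorphism $H:G\to G$ is expanding if there is $C>1$ with $\|H(g)\|\ge C\|g\|$ for all $g\neq e$. $G$ is infinite. Let $H$ be expanding with $H(G)$ of finite index. A set $V\subset G$ is a residue set if $e\in V$ and for each $g\in G$ there are unique $v\in V$ and $g'\in G$ with $g=vH(g')$. A residue set $V$ is a complete digit set if each $g\in G\setminus\{e\}$ has a finite representation $$g=v_0H(v_1)H^2(v_2)\cdots H^n(v_n),\qquad v_i\in V,\ v_n\neq e$$ (necessarily unique); put $\mathsf{Ord}(g)=n$, and $\mathsf{Ord}(e)=0$. A complete digit set is good if there exists $n_0$ such that whenever $\mathsf{Ord}(g)\le n$ and $\mathsf{Ord}(g')\le n$ one has $\mathsf{Ord}(gg')\le n+n_0$. $x\in\Lambda^G$ is $(V,H)$-automatic if there exist a finite set $S$ with a distinguished element $s_0\in S$, maps $\alpha_v:S\to S$ ($v\in V$) and a map $\omega:S\to\Lambda$ such that $x(e)=\omega(s_0)$ and for each $g\in G\setminus\{e\}$ with representation $g=v_0H(v_1)H^2(v_2)\cdots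 H^n(v_n)$, where $v_i\in V$ and $v_n\neq e$, $x(g)=\omega(\alpha_{v_0}\circ\alpha_{v_1}\circ\cdots\circ\alpha_{v_n}(s_0))$. For a finite set $K\subset G$ let $\mathbf C_x(K)$ be the number of blocks $B\in\Lambda^K$ for which there is $g\in G$ with $x(hg)=B(h)$ for all $h\in K$. Then $\mathsf{Rate}(x)=\inf\{\frac{\log_2\mathbf C_x(K)}{|K|}:\emptyset\ne K\subset G\text{ finite}\}$; for amenable $G$ this equals $\lim_m\frac{\log_2\mathbf C_x(K_m)}{|K_m|}$ for any F\o lner sequence $(K_m)$ with $e\in K_m$ for all $m$ (a F\o lner sequence being a sequence of nonempty finite sets with $|KK_m\triangle K_m|/|K_m|\to0$ for each nonempty finite $K\subset G$). *)

(* Defs.v *)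
From mathcomp Require Import all_boot all_order all_algebra.
From mathcomp Require Import finmap.
From mathcomp Require Import all_classical all_reals exp.

Set Implicit Arguments.
Unset Strict Implicit.
Unset Printing Implicit Defensive.

Import Order.TTheory GRing.Theory Num.Theory.

Local Open Scope fset_scope.
Local Open Scope classical_set_scope.
Local Open Scope group_scope.

Definition finitely_generated (G : groupType) : Prop :=
  exists s : seq G, forall A : {pred G},
    group_closed A -> {subset s <= A} -> forall g, g \in A.

Definition is_norm (R : realType) (G : groupType) (N : G -> R) : Prop :=
  [/\ forall g, (0 <= N g)%R,
      forall g, N g = 0%R <-> g = 1,
      forall g, N g = N g^-1
    & forall g g', (N (g * g')%g <= N g + N g')%R].

Definition expanding (R : realType) (G : groupType) (N : G -> R) (H : G -> G)
  : Prop :=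
  exists2 C : R, (1 < C)%R & forall g, g <> 1 -> (C * N g <= N (H g))%R.

(* There are finitely many left cosets [c H(G)]. *)
Definition finite_index_image (G : groupType) (H : G -> G) : Prop :=
  finite_set (range (fun c : G => range (fun g : G => c * H g))).

Definition residue_set (G : groupType) (H : G -> G) (V : set G) : Prop :=
  V 1 /\ forall g, exists! p : G * G, V p.1 /\ g = p.1 * H p.2.

(* [v] lists the digits v_0, ..., v_n in this order. As [last 1 [::]] is [1],
   the condition on the last digit also excludes the empty list. *)
Definition is_representation (G : groupType) (H : G -> G) (V : set G)
    (v : seq G) (g : G) : Prop :=
  [/\ forall d, d \in v -> V d,
      last 1 v <> 1
    & g = \prod_(i < size v) iter i H (v`_i)].

Definition complete_digit_set (G : groupType) (H : G -> G) (V : set G)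
  : Prop :=
  residue_set H V /\
  forall g, g <> 1 -> exists v, is_representation H V v g.

(* Meaningful for a complete digit set, where representations exist and are
   unique; a representation v_0, ..., v_n has order n and length n + 1. *)
Definition Ord (G : groupType) (H : G -> G) (V : set G) (g : G) : nat :=
  if g == 1 then 0%N
  else xget 0%N [set n | exists2 v, size v = n.+1 & is_representation H V v g].

Definition good_complete_digit_set (G : groupType) (H : G -> G) (V : set G)
  : Prop :=
  complete_digit_set H V /\
  exists n0 : nat, forall (n : nat) (g g' : G),
    (Ord H V g <= n)%N -> (Ord H V g' <= n)%N ->
    (Ord H V (g * g') <= n + n0)%N.

(* The maps [alpha v] are only used for digits [v] in [V], and
   [foldr alpha s0 [:: v_0; ...; v_n]] is
   [alpha v_0 (alpha v_1 (... (alpha v_n s0)))]. *)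
Definition automatic (G : groupType) (H : G -> G) (V : set G)
    (L : finType) (x : G -> L) : Prop :=
  exists (S : finType) (s0 : S) (alpha : G -> S -> S) (omega : S -> L),
    x 1 = omega s0 /\
    forall (g : G) (v : seq G), g <> 1 -> is_representation H V v g ->
      x g = omega (foldr alpha s0 v).

Definition block_count (G : groupType) (L : finType) (x : G -> L)
    (K : {fset G}) : nat :=
  #|[pred B : {ffun K -> L} |
      `[< exists g : G, forall h : K, x (val h * g) = B h >]]|.

Definition Rate (R : realType) (G : groupType) (L : finType) (x : G -> L)
  : R :=
  inf [set r : R | exists2 K : {fset G}, K != fset0 &
    r = (ln (block_count x K)%:R / ln 2 / (#|` K|)%:R)%R].

(* Main.v *)
Require Import Defs.
From mathcomp Require Import all_boot all_order all_algebra.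
From mathcomp Require Import finmap.
From mathcomp Require Import all_classical all_reals exp.
From mathcomp Require Import ring.

(** The windows are the sets D m of elements whose digit expansion has at most
    m digits, for m >= 1. Every g splits as q H^m(r) with q in D m (lemma
    [division]): q collects the first m digits and r the remaining ones. For h and q in D m,
    goodness gives hq in D (m + n0), so dividing hq again yields
      hg = hq H^m(r) = k H^m(c) H^m(r) = k H^m(c r)
    with k in D m and c in D n0. The automaton reads the first m digits, those
    of k, last; hence x(hg) depends only on k and on the state that it has
    reached after reading the expansion of c r (lemma [state_map_prefix]). As k
    and c are determined by h and q, the whole block of x at g over the window
    D m is determined by q and by the map sending each c in D n0 to the state
    of c r. So at most |D m| |S|^|D n0| blocks occur over D m, where S is the
    set of states (lemma [block_count_leq_card]). These are the states of the
    automaton together with a flag that marks the element 1, whose empty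
    expansion behaves differently under prefixing of the digit 1 (lemma
    [automatic_state_map]).

    The second factor is a constant M. The sets D m are finite, since the
    digits are representatives of the finitely many cosets of the image of H,
    and they exhaust the infinite group, so their sizes t are unbounded. Hence
    log (t M) / t tends to 0 along the windows, which forces the infimum to
    vanish (lemma [Rate_eq0]). *)

Set Implicit Arguments.
Unset Strict Implicit.
Unset Printing Implicit Defensive.

Import Order.TTheory GRing.Theory Num.Theory.

(** * Digit expansions *)

Section DigitExpansions.

Local Open Scope classical_set_scope.
Local Open Scope group_scope.

Variables (G : groupType) (H : {multiplicative G -> G}) (V : set G).

Lemma multiplicative1 : H 1 = 1.
Proof. by apply: (mulgI (H 1)); rewrite -gmulfM !mulg1. Qed.

(** The value at 1, which has no representation, is the default [[::]]. This
    is the right convention: it makes 1 the only element without digits, and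
    the expansion of a product v H(g) <> 1 the expansion of g preceded by v,
    also when g = 1. *)
Definition digits (g : G) : seq G :=
  xget [::] [set v | is_representation H V v g].

Definition expansion_value (s : seq G) : G := \prod_(i < size s) iter i H s`_i.

Lemma expansion_value_cons v s :
  expansion_value (v :: s) = v * H (expansion_value s).
Proof.
rewrite /expansion_value big_ord_recl; congr (_ * _).
by rewrite (big_morph H (gmulfM (s := H)) multiplicative1).
Qed.

Hypothesis residueV : residue_set H V.

(** With v = v' this is the injectivity of H, and with g and g' arbitrary it
    says that distinct digits lie in distinct left cosets of the image. *)
Lemma residue_inj v v' g g' :
  V v -> V v' -> v * H g = v' * H g' -> v = v' /\ g = g'.
Proof.
move=> Vv Vv' e; case: residueV => _ /(_ (v * H g)) [p [_ up]].
by have [-> ->] : (v, g) = (v', g') by rewrite -(up (v, g)) // -(up (v', g')).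
Qed.

Lemma residue_inj1 v g : V v -> v * H g = 1 -> v = 1 /\ g = 1.
Proof.
move=> Vv e; apply: residue_inj => //; first by case: residueV.
by rewrite e multiplicative1 mulg1.
Qed.

Lemma residue_div g : exists v q, V v /\ g = v * H q.
Proof. by case: residueV => _ /(_ g) [[v q] [? _]]; exists v, q. Qed.

Lemma finite_digits : finite_index_image H -> finite_set V.
Proof.
pose coset c := range (fun g : G => c * H g).
move=> finH; suff: finite_set (coset @` V).
  rewrite (eq_finite_set (inj_card_eq _)) // => v v' /set_mem Vv /set_mem Vv' e.
  have : coset v v by exists 1; rewrite // multiplicative1 mulg1.
  rewrite e => -[g _ e']; suff [] : v' = v /\ g = 1 by [].
  by apply: residue_inj => //; rewrite e' multiplicative1 mulg1.
by apply: sub_finite_set finH => _ [c _ <-]; exists c.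
Qed.

(** Since 1 = 1 H(1) is the only decomposition of 1, an expansion of 1 has
    only the digit 1; the last digit is what separates it from a
    representation. *)
Lemma last_digit_value1 s :
  (forall d, d \in s -> V d) -> expansion_value s = 1 -> last 1 s = 1.
Proof.
elim: s => // v s IH Vs; rewrite expansion_value_cons.
move=> /residue_inj1[|-> /IH]; first by apply: Vs; rewrite mem_head.
by apply=> d ds; apply: Vs; rewrite in_cons ds orbT.
Qed.

(** The empty expansion is allowed besides the representations so that the
    hypotheses pass to the tails, as the induction requires. *)
Lemma expansion_value_inj s t :
  (forall d, d \in s -> V d) -> (forall d, d \in t -> V d) ->
  s = [::] \/ last 1 s <> 1 -> t = [::] \/ last 1 t <> 1 ->
  expansion_value s = expansion_value t -> s = t.
Proof.
have tl v u : v :: u = [::] \/ last 1 (v :: u) <> 1 ->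
    u = [::] \/ last 1 u <> 1.
  by case: u => [|w u]; [left | case=> // ?; right].
have val0 : expansion_value [::] = 1 by rewrite /expansion_value big_ord0.
elim: s t => [|v s IH] [|w t] // Vs Vt ns nt.
- by rewrite val0 => /esym/(last_digit_value1 Vt); case: nt.
- by rewrite val0 => /(last_digit_value1 Vs); case: ns.
rewrite !expansion_value_cons => /residue_inj[||-> e].
- by apply: Vs; rewrite mem_head.
- by apply: Vt; rewrite mem_head.
congr cons; apply: IH => //; [| |exact: tl ns|exact: tl nt].
- by move=> d ds; apply: Vs; rewrite in_cons ds orbT.
- by move=> d dt; apply: Vt; rewrite in_cons dt orbT.
Qed.

Lemma digits_representation v g : is_representation H V v g -> digits g = v.
Proof.
move=> rv; apply: xget_unique => // w [Vw lw ew]; case: rv => Vv lv ev.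
by apply: expansion_value_inj; [| |right..|rewrite /expansion_value -ev].
Qed.

Lemma digits1 : digits 1 = [::].
Proof.
rewrite /digits; case: xgetP => // v _ [Vv lv ev].
by case: lv; apply: last_digit_value1 => //; rewrite -ev.
Qed.

Hypothesis completeV : forall g, g <> 1 -> exists v, is_representation H V v g.

Lemma digitsP g : g <> 1 -> is_representation H V (digits g) g.
Proof. by move=> /completeV gex; apply: xgetPex gex. Qed.

Lemma digits_cons v g :
  V v -> v * H g <> 1 -> digits (v * H g) = v :: digits g.
Proof.
move=> Vv ne1; apply: digits_representation.
have [g1|/eqP/digitsP[Vs ls es]] := eqVneq g 1.
  move: ne1; rewrite g1 digits1 multiplicative1 mulg1 => ne1; split=> //.
    by move=> d; rewrite inE => /eqP->.
  by rewrite /= big_ord1.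
split; first by move=> d; rewrite in_cons => /orP[/eqP->|/Vs].
  by case: (digits g) ls.
by rewrite -/(expansion_value _) expansion_value_cons /expansion_value -es.
Qed.

Lemma size_digits_gt0 g : g <> 1 -> 0 < size (digits g).
Proof. by move=> /digitsP[_]; case: (digits g). Qed.

(** Both conventions at 1 agree here: [Ord] is 0 there, and so is the
    predecessor of the length 0. *)
Lemma Ord_digits g : Ord H V g = (size (digits g)).-1.
Proof.
rewrite /Ord; case: eqP => [->|/[dup] g1 /digitsP gd]; first by rewrite digits1.
apply: xget_unique.
  by exists (digits g) => //; rewrite prednK // size_digits_gt0.
by move=> n [v sv /digits_representation->]; rewrite sv.
Qed.

Lemma Ord_leq g n : (Ord H V g <= n) = (size (digits g) <= n.+1).
Proof. by rewrite Ord_digits; case: (size _). Qed.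

Lemma size_digits_cons v g :
  V v -> size (digits (v * H g)) <= (size (digits g)).+1.
Proof.
move=> Vv; have [->|/eqP ne1] := eqVneq (v * H g) 1; first by rewrite digits1.
by rewrite digits_cons.
Qed.

Lemma size_digits_div v g :
  V v -> size (digits g) <= (size (digits (v * H g))).-1.
Proof.
move=> Vv; have [e|/eqP ne1] := eqVneq (v * H g) 1.
  by have [_ ->] := residue_inj1 Vv e; rewrite digits1.
by rewrite digits_cons.
Qed.

(** Stripping the first m digits of g leaves r, with the remaining ones, so
    the length drops by m as long as there are m digits to strip. This
    bound is what turns goodness into a bound on the carry c in hq = k H^m(c). *)
Lemma division m g : exists q r,
  [/\ size (digits q) <= m, size (digits r) <= size (digits g) - m
    & g = q * iter m H r].
Proof.
elim: m g => [|m IH] g; first by exists 1, g; rewrite digits1 subn0 mul1g.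
have [v [g' [Vv ->]]] := residue_div g.
have [q [r [qm rm e]]] := IH g'.
exists (v * H q), r; split; last by rewrite e gmulfM mulgA.
  by apply: leq_trans (size_digits_cons _ Vv) _.
apply: leq_trans rm (leq_trans (leq_sub2r _ (size_digits_div _ Vv)) _).
by rewrite subnS predn_sub.
Qed.

Lemma size_digits_eq0 g : size (digits g) <= 0 -> g = 1.
Proof.
by move=> g0; apply: contrapT => /size_digits_gt0; rewrite ltnNge g0.
Qed.

Definition short_set m : set G := [set g | size (digits g) <= m].

Lemma finite_short_set m : finite_set V -> finite_set (short_set m).
Proof.
move=> finV; elim: m => [|m IH].
  by apply: (sub_finite_set _ (finite_set1 1)) => g /size_digits_eq0.
apply: (sub_finite_set _ (finite_image2 (fun v g => v * H g) finV IH)) => g.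
have [v [q [Vv ->]]] := residue_div g.
rewrite /short_set /= => vq; exists v => //; exists q => //=.
by apply: leq_trans (size_digits_div _ Vv) _; case: size vq.
Qed.

Lemma infinite_short_set : infinite_set [set: G] -> finite_set V ->
  forall n, exists m, n <= #|` fset_set (short_set m.+1)|.
Proof.
move=> infG finV n; have [B _ nB] := infinite_set_fset n infG.
exists (\max_(b <- B) size (digits b)); apply: leq_trans nB _.
apply: fsubset_leq_card; apply/fsubsetP => b bB.
rewrite in_fset_set; last exact: finite_short_set.
apply/mem_set/leqW; exact: leq_bigmax_seq.
Qed.

(** The defining recursion of an automaton fails where a leading digit would
    be 1, because the expansion of 1 = 1 H(1) is empty and not the digit 1.
    Recording in the state whether the element is 1 makes the recursion hold
    for all v and g. *)
Lemma automatic_state_map (L : finType) (x : G -> L) : automatic H V x ->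
  exists (S : finType) (state : G -> S) (step : G -> S -> S) (out : S -> L),
    (forall g, x g = out (state g)) /\
    (forall v g, V v -> state (v * H g) = step v (state g)).
Proof.
case=> S [s0 [alpha [omega [x1 xg]]]].
exists (S * bool)%type, (fun g => (foldr alpha s0 (digits g), g == 1)).
exists (fun v s =>
  if (v == 1) && s.2 then (s0, true) else (alpha v s.1, false)).
exists (fun s => omega s.1); split=> [g|v g Vv] /=.
  have [->|/eqP g1] := eqVneq g 1; first by rewrite digits1.
  exact: xg g1 (digitsP g1).
case: ifP => [/andP[/eqP-> /eqP->]|vg1].
  by rewrite multiplicative1 mulg1 digits1 eqxx.
have ne1 : v * H g <> 1.
  by move=> /(residue_inj1 Vv)[v1 g1]; rewrite v1 g1 !eqxx in vg1.
by rewrite digits_cons //; congr pair; apply/eqP.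
Qed.

(** Only the state of r matters once it is multiplied by H^m, because the
    first m digits are then exactly used up by q; no padding of the expansion
    of q to length m is needed, as its missing digits are supplied by
    decompositions 1 = 1 H(1). *)
Lemma state_map_prefix (S : Type) (state : G -> S) (step : G -> S -> S)
    m q r r' :
  (forall v g, V v -> state (v * H g) = step v (state g)) ->
  size (digits q) <= m -> state r = state r' ->
  state (q * iter m H r) = state (q * iter m H r').
Proof.
move=> st; elim: m q => [|m IH] q qm rr'.
  by rewrite (size_digits_eq0 qm) !mul1g.
have [v [q' [Vv e]]] := residue_div q.
rewrite e !iterS -!mulgA -!gmulfM !st // (IH q') //.
by apply: leq_trans (size_digits_div _ Vv) _; rewrite -e; case: size qm.
Qed.

End DigitExpansions.

(** * Counting blocks *)

Section BlockCounting.

Local Open Scope fset_scope.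
Local Open Scope group_scope.

Variables (G : groupType) (L : finType) (x : G -> L).

Lemma block_count_leq_card (K : {fset G}) (C : finType) (code : G -> C) :
  (forall g g', code g = code g' ->
     forall h, h \in K -> x (h * g) = x (h * g')) ->
  (block_count x K <= #|C|)%N.
Proof.
move=> codeP.
pose block (g : G) : {ffun K -> L} := [ffun h : K => x (val h * g)].
pose center (B : {ffun K -> L}) : G := xget 1 [set g | block g = B]%classic.
have centerK (B : {ffun K -> L}) :
    B \in [pred B : {ffun K -> L} |
             `[< exists g : G, forall h : K, x (val h * g) = B h >]] ->
    block (center B) = B.
  move=> /asboolP[g gB]; apply: (@xgetI _ 1 [set g | block g = B]%classic g).
  by rewrite /mkset; apply/ffunP => h; rewrite ffunE.
rewrite /block_count -(@card_in_imset _ _ (code \o center)) ?max_card //.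
move=> B B' /centerK BK /centerK B'K /codeP e; rewrite -BK -B'K.
by apply/ffunP => h; rewrite !ffunE e // fsvalP.
Qed.

(** For windows of unbounded size t, a bound t M on the number of blocks
    suffices: ln (t M) = ln (d t) + ln (M / d) <= d t + M / d for every d > 0,
    and the last term is at most d t once t >= M / d^2. *)
Lemma Rate_eq0 (R : realType) (M : nat) :
  (forall n, exists2 K : {fset G},
     (n <= #|` K|)%N & (block_count x K <= #|` K| * M)%N) ->
  Rate R x = 0%R.
Proof.
move=> HK; rewrite /Rate; set E := (X in inf X).
have lbE : lbound E 0%R.
  move=> _ [K _ ->].
  rewrite divr_ge0 ?ler0n // divr_ge0 //; last by rewrite ln_ge0 // ler1n.
  by case: block_count => [|b]; [rewrite ln0 | apply: ln_ge0; rewrite ler1n].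
apply/eqP; rewrite eq_le; apply/andP; split; last first.
  apply: lb_le_inf lbE; have [K K0 _] := HK 1%N.
  by exists (ln (block_count x K)%:R / ln 2 / #|` K|%:R)%R, K;
    rewrite -?cardfs_gt0.
apply/ler_addgt0Pr => e e0; rewrite add0r.
have ln2 : (0 < ln 2 :> R)%R by rewrite ln_gt0 // ltr1n.
(* Each of the two summands of ln (d t) + ln (M / d) gets half of the margin. *)
have [d d0 dE] : exists2 d : R, (0 < d)%R & (e * ln 2 = d + d)%R.
  exists (e * ln 2 / 2)%R; last by rewrite -splitr.
  by rewrite divr_gt0 ?mulr_gt0.
have [K tK bK] := HK (Num.bound (M%:R / d / d : R)%R).+1.
have K0 : (0 < #|` K|)%N by apply: leq_trans tK.
set t : R := #|` K|%:R%R.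
have t0 : (0 < t)%R by rewrite ltr0n.
apply: (@le_trans _ _ (ln (block_count x K)%:R / ln 2 / t)%R).
  apply: ge_inf; first by exists 0%R.
  by exists K; rewrite // -cardfs_gt0.
rewrite !ler_pdivrMr //.
have -> : (e * t * ln 2 = d * t + d * t)%R by rewrite mulrAC dE mulrDl.
have Mdt : (M%:R / d <= d * t)%R.
  rewrite [leRHS]mulrC -ler_pdivrMr //.
  apply: le_trans (ltW (archi_boundP _)) _.
    by rewrite !divr_ge0 ?ler0n // (ltW d0).
  by rewrite ler_nat ltnW.
(* Logarithms compare only at positive arguments; ln 0 is 0 by convention. *)
case: (posnP (block_count x K)) => [->|b0].
  by rewrite ln0 // addr_ge0 // mulr_ge0 // ltW.
have M0 : (0 < M)%N
  by rewrite lt0n; apply: contraTneq bK => ->; rewrite muln0 leqNgt b0.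
have Md0 : (0 < M%:R / d)%R by rewrite divr_gt0 // ltr0n.
have dt0 : (0 < d * t)%R by rewrite mulr_gt0.
apply: (@le_trans _ _ (ln ((d * t) * (M%:R / d)))%R).
  rewrite ler_ln ?posrE ?(mulr_gt0 dt0 Md0) ?ltr0n //.
  have -> : (d * t * (M%:R / d) = (#|` K| * M)%:R)%R.
    by rewrite natrM -/t; field; rewrite gt_eqF.
  by rewrite ler_nat.
rewrite lnM ?posrE // lerD //; first exact/ltW/ln_sublinear.
by apply: le_trans Mdt; exact/ltW/ln_sublinear.
Qed.

End BlockCounting.

(** * Zero rate *)

Theorem proposition7p6 (R : realType) (G : groupType) (N : G -> R)
    (H : {multiplicative G -> G}) (V : set G) (L : finType) (x : G -> L) :
  infinite_set [set: G]%classic ->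
  finitely_generated G ->
  is_norm N ->
  expanding N H ->
  finite_index_image H ->
  good_complete_digit_set H V ->
  automatic H V x ->
  Rate R x = 0%R.
Proof.
move=> infG _ _ _ finH [[resV compV] [n0 good]] autx.
have finV := finite_digits resV finH.
have [S [state [step [out [xE stateE]]]]] :=
  automatic_state_map resV compV autx.
pose D m := fset_set (short_set H V m).
have inD m g : (g \in D m) = (size (digits H V g) <= m).
  rewrite in_fset_set; last exact: finite_short_set.
  by apply/idP/idP => [/set_mem|/mem_set].
apply: (@Rate_eq0 _ _ _ _ (#|S| ^ #|` D n0|)) => n.
(* Goodness bounds orders, and order at most m means at most m + 1 digits; so
   the window is D m.+1, which [infinite_short_set] provides. *)
have [m nm] := infinite_short_set resV compV infG finV n.
exists (D m.+1) => //.
(* The code of g: the first digits q of g, and the states of all c r. *)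
have /choice[code codeP] (g : G) :
    exists c : D m.+1 * {ffun D n0 -> S}, exists r : G,
      g = (val c.1 * iter m.+1 H r)%g /\
      forall k : D n0, c.2 k = state (val k * r)%g.
  have [q [r [qm _ ->]]] := division resV compV m.+1 g.
  have qD : q \in D m.+1 by rewrite inD.
  exists ([` qD]%fset, [ffun k => state (val k * r)%g]), r.
  by split=> // k; rewrite ffunE.
rewrite !cardfE -card_ffun -card_prod.
apply: (@block_count_leq_card _ _ _ _ _ code) => g g' gg' h.
rewrite inD !xE => hm.
have [r [eg rP]] := codeP g; have [r' [eg' r'P]] := codeP g'.
rewrite -gg' in eg' r'P; set q := val (code g).1 in eg eg'.
rewrite eg eg'.
have qm : size (digits H V q) <= m.+1 by rewrite -inD fsvalP.
have hqm : size (digits H V (h * q)%g) <= m.+1 + n0.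
  by rewrite addSn -Ord_leq //; apply: good; rewrite Ord_leq.
(* The product hq overflows the window by a carry c with at most n0 digits. *)
have [k [c [km cm hq]]] := division resV compV m.+1 (h * q)%g.
have cD : c \in D n0.
  by rewrite inD (leq_trans cm) // leq_subLR.
have iterM j : {morph iter j H : a b / (a * b)%g}.
  by elim: j => // j IH a b; rewrite !iterS IH gmulfM.
rewrite !mulgA hq -!mulgA -!iterM; congr out.
apply: (state_map_prefix resV compV stateE) => //.
by have := rP [` cD]%fset; rewrite (r'P [` cD]%fset).
Qed.
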